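(* Suppose that $\omega\in C^0(M,\mathbb{R})$ is bounded. Then for any $m\in M$ and initial state $x(0)=x_0\in\mathbb{R}^N$, the linear reservoir system $$\dot{x}(t)=-Ax(t)+C\,\omega\phi^t(m)$$ admits the unique solution $x:\mathbb{R}\to\mathbb{R}^N$ defined by $$x(t)=\int_0^\infty e^{-A\tau}C\,\omega\phi^{-\tau+t}(m)\,d\tau+e^{-At}\left(x_0-\int_0^\infty e^{-A\tau}C\,\omega\phi^{-\tau}(m)\,d\tau\right),$$ and the associated generalised synchronisation is $$f_{(\omega,\mathcal{V},F)}(m)=\int_0^\infty e^{-A\tau}C\,\omega\phi^{-\tau}(m)\,d\tau ,$$ i.e. the map $f_{(\omega,\mathcal{V},F)}:M\to\mathbb{R}^N$ so defined is an $\mathbb{R}^N$-generalised synchronisation for the linear reservoir system.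
   Context: $M$ is a smooth manifold and $\mathcal{V}$ is a smooth vector field on $M$ with evolution operators (flow) $\{\phi^t\in\mathrm{Diff}^1(M)\mid t\in\mathbb{R}\}$, defined for all times and satisfying $\phi^{t_1+t_2}=\phi^{t_1}\phi^{t_2}$. Juxtaposition denotes composition, e.g. $\omega\phi^t(m)=\omega(\phi^t(m))$. $A$ is a real symmetric positive definite $N\times N$ matrix and $C$ is a real $N\times1$ matrix (a vector in $\mathbb{R}^N$). The reservoir map is $F(x,z)=-Ax+Cz$. For $V\subset\mathbb{R}^N$, a map $f:M\to\mathbb{R}^N$ is a $V$-generalised synchronisation for the system if for every $r\in V$ and $m\in M$ the solution $x^r_m(t)$ of $\dot{x}(t)=F(x(t),\omega\phi^t(m))$ with $x^r_m(0)=r$ satisfies $\lim_{t\to\infty}\|f\phi^t(m)-x^r_m(t)\|=0$. *)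

(* Defs.v *)
From HB Require Import structures.
From mathcomp Require Import all_boot all_order all_algebra.
From mathcomp Require Import all_classical all_reals all_analysis.

Set Implicit Arguments.
Unset Strict Implicit.
Unset Printing Implicit Defensive.

Import Order.TTheory GRing.Theory Num.Theory.
Import numFieldNormedType.Exports.

Local Open Scope classical_set_scope.
Local Open Scope ring_scope.

(* Only meaningful for [U] open, as is the case in all uses below. *)
Fixpoint C_on (R : realType) (n p k : nat) (U : set 'rV[R]_n)
    (f : 'rV[R]_n -> 'rV[R]_p) : Prop :=
  if k is k'.+1 then
    (forall x, U x -> differentiable f x) /\
    (forall i : 'I_n, C_on k' U (fun x => 'D_(delta_mx 0 i) f x))
  else {in U, continuous f}.

Definition smooth_on (R : realType) (n p : nat) (U : set 'rV[R]_n)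
    (f : 'rV[R]_n -> 'rV[R]_p) : Prop :=
  forall k, C_on k U f.

(* [chart_map] and [chart_inv] are total functions, of which only the restrictions to
   [chart_dom] and [chart_map @` chart_dom] matter. *)
Record chart (R : realType) (n : nat) (M : topologicalType) := Chart {
  chart_dom : set M ;
  chart_map :> M -> 'rV[R]_n ;
  chart_inv : 'rV[R]_n -> M ;
  chart_dom_open : open chart_dom ;
  chart_codom_open : open (chart_map @` chart_dom) ;
  chart_mapK : {in chart_dom, cancel chart_map chart_inv} ;
  chart_map_continuous : {in chart_dom, continuous chart_map} ;
  chart_inv_continuous : {in chart_map @` chart_dom, continuous chart_inv} }.

Record manifold (R : realType) (n : nat) := Manifold {
  points :> topologicalType ;
  atlas : set (chart R n points) ;
  points_hausdorff : hausdorff_space points ;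
  points_second_countable : @second_countable points ;
  atlas_cover : forall m, exists2 c, atlas c & chart_dom c m ;
  atlas_smooth : forall c c', atlas c -> atlas c' ->
    smooth_on (c @` (chart_dom c `&` chart_dom c')) (c' \o chart_inv c) }.

(* A tangent vector at [m] is given by its components in every chart around
   [m]; [vf_comp c m] holds the components in the chart [c]. *)
Record vectorField (R : realType) (n : nat) (M : manifold R n) := VectorField {
  vf_comp :> chart R n M -> M -> 'rV[R]_n ;
  vf_smooth : forall c, atlas c ->
    smooth_on (c @` chart_dom c) (vf_comp c \o chart_inv c) ;
  vf_change : forall c c' m, atlas c -> atlas c' ->
    chart_dom c m -> chart_dom c' m ->
    vf_comp c' m = 'd (c' \o chart_inv c) (c m) (vf_comp c m) }.

Definition C1_map (R : realType) (n : nat) (M : manifold R n)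
    (g : M -> M) : Prop :=
  continuous g /\
  forall c c', atlas c -> atlas c' ->
    C_on 1 (c @` (chart_dom c `&` g @^-1` chart_dom c')) (c' \o g \o chart_inv c).

Definition diffeo1 (R : realType) (n : nat) (M : manifold R n)
    (g : M -> M) : Prop :=
  C1_map g /\ exists h : M -> M, [/\ C1_map h, cancel g h & cancel h g].

Definition integral_curve (R : realType) (n : nat) (M : manifold R n)
    (V : vectorField M) (gamma : R -> M) : Prop :=
  continuous gamma /\
  forall c t, atlas c -> chart_dom c (gamma t) ->
    is_derive t (1 : R) (c \o gamma) (V c (gamma t)).

Definition is_flow (R : realType) (n : nat) (M : manifold R n)
    (V : vectorField M) (phi : R -> M -> M) : Prop :=
  [/\ forall t, diffeo1 (phi t),
      phi 0 = id,
      forall t1 t2, phi (t1 + t2) = phi t1 \o phi t2 &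
      forall m, integral_curve V (phi ^~ m)].

Definition posdefmx (R : realType) (N : nat) (A : 'M[R]_N) : Prop :=
  forall x : 'cV[R]_N, x != 0 -> 0 < (x^T *m A *m x) 0 0.

Definition expmx (R : realType) (N : nat) (A : 'M[R]_N) : 'M[R]_N :=
  lim (series (fun k => (k`!%:R)^-1 *: A ^+ k) @ \oo).

Definition integrable_cV (R : realType) (N : nat) (D : set R)
    (f : R -> 'cV[R]_N) : Prop :=
  forall i, (@lebesgue_measure R).-integrable D (fun t => (f t i 0)%:E).

Definition integral_cV (R : realType) (N : nat) (D : set R)
    (f : R -> 'cV[R]_N) : 'cV[R]_N :=
  \col_i \int[@lebesgue_measure R]_(t in D) f t i 0.

Section reservoir.
Context (R : realType) (N : nat) (M : Type).
Implicit Types (F : 'cV[R]_N -> R -> 'cV[R]_N) (phi : R -> M -> M).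
Implicit Types (omega : M -> R).

Definition is_solution F phi omega (m : M) (r : 'cV[R]_N)
    (x : R -> 'cV[R]_N) : Prop :=
  x 0 = r /\
  forall t, is_derive t (1 : R) x (F (x t) (omega (phi t m))).

Definition generalised_synchronisation F phi omega (V : set 'cV[R]_N)
    (f : M -> 'cV[R]_N) : Prop :=
  forall r m, V r ->
    exists2 x, unique (is_solution F phi omega m r) x &
      `|f (phi t m) - x t| @[t --> +oo] --> 0.

Definition linear_reservoir (A : 'M[R]_N) (C : 'cV[R]_N) :
    'cV[R]_N -> R -> 'cV[R]_N :=
  fun x z => - A *m x + z *: C.

End reservoir.

(* Main.v *)
(* Put E(t) = e^{-tA} and g(s) = omega(phi^s m). As A is positive definite, the
   energy |E(t) u|^2 decays exponentially, so the improper integrals I(t)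
   converge. If K is an antiderivative of s |-> e^{sA} C g(s), then
   tau |-> - E(t) K(t - tau) is an antiderivative of the integrand of I(t);
   hence K has a limit L at -oo and I(t) = E(t) (K(t) - L). The proposed
   solution is therefore E(t) (x0 + K(t) - K(0)), which solves the equation by
   the product rule, and it differs from I(t) = f(phi^t m) by
   E(t) (x0 - I(0)), which tends to 0. Uniqueness holds because
   e^{tA} (x(t) - y(t)) is constant for any two solutions x and y. *)
Require Import Defs.
From HB Require Import structures.
From mathcomp Require Import all_boot all_order all_algebra.
From mathcomp Require Import all_classical all_reals all_analysis.
From mathcomp Require Import measurable_realfun.
From mathcomp Require Import ring lra.

Set Implicit Arguments.
Unset Strict Implicit.
Unset Printing Implicit Defensive.

Import Order.TTheory GRing.Theory Num.Theory.
Import numFieldNormedType.Exports.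

Local Open Scope classical_set_scope.
Local Open Scope ring_scope.

(** * Entrywise limits and derivatives of matrix-valued functions *)

Section matrix_limits.
Context {R : realType}.

(** The matrix norm is the maximum over finitely many entries, and a filter is closed under finite
    intersections. *)
Lemma cvg_mx {T : Type} {F : set_system T} {FF : Filter F} {m n : nat}
    (f : T -> 'M[R]_(m, n)) (l : 'M[R]_(m, n)) :
  (forall i j, f x i j @[x --> F] --> l i j) -> f x @[x --> F] --> l.
Proof.
move=> fl; apply/cvgrPdist_le => e e0; near=> x.
rewrite /Num.Def.normr/= mx_normrE (bigmax_le _ (ltW e0))//= => i _.
rewrite !mxE; move: i; near: x; apply: filter_forall => /= i.
exact: ((cvgrPdist_le _ _).1 (fl i.1 i.2)).
Unshelve. all: by end_near. Qed.

Lemma cvg_sumr {T I : Type} {F : set_system T} {FF : Filter F} (r : seq I)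
    (f : I -> T -> R) (l : I -> R) :
  (forall i, f i x @[x --> F] --> l i) ->
  \sum_(i <- r) f i x @[x --> F] --> \sum_(i <- r) l i.
Proof.
move=> fl; elim: r => [|i r IH].
  by under eq_fun do rewrite big_nil; rewrite big_nil; exact: cvg_cst.
by under eq_fun do rewrite big_cons; rewrite big_cons; exact: cvgD.
Qed.

Lemma is_derive_mxP {V : normedModType R} {m n : nat} (f : V -> 'M[R]_(m, n))
    (t v : V) (df : 'M[R]_(m, n)) :
  is_derive t v f df <->
  forall i j, is_derive t v (fun x => f x i j) (df i j).
Proof.
split=> [[dv dE] i j|fij].
  apply: DeriveDef; first exact: (derivable_mxP f t v).1 dv i j.
  by rewrite -dE derive_mx// mxE.
have dv : derivable f t v by apply/derivable_mxP => i j; case: (fij i j).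
apply: DeriveDef => //; rewrite derive_mx//.
by apply/matrixP => i j; rewrite mxE; case: (fij i j).
Qed.

Lemma is_derive_mulmx {V : normedModType R} {m n p : nat}
    (f : V -> 'M[R]_(m, n)) (g : V -> 'M[R]_(n, p)) (t v : V)
    (df : 'M[R]_(m, n)) (dg : 'M[R]_(n, p)) :
  is_derive t v f df -> is_derive t v g dg ->
  is_derive t v (fun x => f x *m g x) (df *m g t + f t *m dg).
Proof.
move=> /is_derive_mxP fd /is_derive_mxP gd; apply/is_derive_mxP => i j.
have -> : (fun x => (f x *m g x) i j) =
          \sum_(k < n) ((fun x => f x i k) * (fun x => g x k j)).
  by apply/funext => x; rewrite fct_sumE mxE.
have := @is_derive_sum R V _ n
  (fun k => (fun x => f x i k) * (fun x => g x k j))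
  t v _ (fun k => is_deriveM (fd i k) (gd k j)).
move/is_derive_eq; apply.
rewrite !mxE -big_split; apply: eq_bigr => k _ /=.
by rewrite addrC [_ *: df _ _]mulrC.
Qed.

Lemma is_derive_mx_subr {m n : nat} (f : R -> 'M[R]_(m, n)) (c t : R)
    (df : 'M[R]_(m, n)) :
  is_derive (c - t) (1 : R) f df ->
  is_derive t (1 : R) (fun x => f (c - x)) (- df).
Proof.
move=> /is_derive_mxP fd; apply/is_derive_mxP => i j.
have dc : is_derive t (1 : R) (fun x => c - x) (-1).
  by have := is_deriveB (is_derive_cst c t 1) (is_derive_id t 1); rewrite sub0r.
apply: is_derive_eq.
  exact: (@is_derive1_comp R (fun x => f x i j) (fun x => c - x)).
by rewrite mxE mulrN1.
Qed.

Lemma is_derive_mx_0_is_cst {m n : nat} (f : R -> 'M[R]_(m, n)) (x y : R) :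
  (forall t, is_derive t (1 : R) f 0) -> f x = f y.
Proof.
move=> fd; apply/matrixP => i j.
apply: (@is_derive_0_is_cst R (fun x => f x i j)) => t.
by have /is_derive_mxP/(_ i j) := fd t; rewrite mxE.
Qed.

End matrix_limits.

(** * The matrix exponential as an entrywise power series *)

Section matrix_exponential.
Context {R : realType} {N : nat}.
Implicit Types A : 'M[R]_N.

(** Induction on [k]: the sum of all absolute entries dominates each absolute row sum, so every
    further factor [A] costs at most that sum. *)
Lemma ler_norm_mx_expr A k (i j : 'I_N) :
  `|(A ^+ k) i j| <= (\sum_i \sum_j `|A i j|) ^+ k.
Proof.
set a := \sum_i _.
have a0 : 0 <= a by apply: sumr_ge0 => ? _; exact: sumr_ge0.
elim: k i j => [|k IH] i j.
  by rewrite !expr0 mxE; case: eqP; rewrite ?normr1 ?normr0.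
rewrite exprS mxE (le_trans (ler_norm_sum _ _ _))//.
apply: (@le_trans _ _ (\sum_l `|A i l| * a ^+ k)).
  by apply: ler_sum => l _; rewrite normrM ler_wpM2l.
rewrite -mulr_suml exprS ler_wpM2r ?exprn_ge0// [leRHS](bigD1 i)//= lerDl.
by apply: sumr_ge0 => ? _; exact: sumr_ge0.
Qed.

Lemma scalemx_expr (t : R) A k : (t *: A) ^+ k = t ^+ k *: A ^+ k.
Proof.
elim: k => [|k IH]; first by rewrite !expr0 scale1r.
rewrite !exprS IH -[LHS]scalemxAl -[A * _ in RHS]/(A *m _).
by rewrite -scalemxAr scalerA.
Qed.

(** Power series coefficients in t of the entry (i, j) of A^m e^{tA}. The shift [m] is there so that
    termwise differentiation just raises it by one. *)
Let coef A (i j : 'I_N) (m k : nat) : R := (A ^+ (k + m)) i j / k`!%:R.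

Let coef_diffs A i j m : pseries_diffs (coef A i j m) = coef A i j m.+1.
Proof.
apply/funext => k; rewrite /pseries_diffs /coef addSnnS factS natrM invfM.
by rewrite mulrCA mulVKf.
Qed.

(** Domination by a^m times the scalar exponential series at a|x|, where a is the sum of the
    absolute entries of [A]. *)
Let is_cvg_coef A i j m x : cvgn (pseries (coef A i j m) x).
Proof.
set a := \sum_i \sum_j `|A i j|.
have a0 : 0 <= a by apply: sumr_ge0 => ? _; exact: sumr_ge0.
apply: normed_cvg.
apply: (@series_le_cvg _ _ (a ^+ m *: exp_coeff (a * `|x|))) => [k|k|k|].
- exact: normr_ge0.
- by rewrite mulr_ge0 ?exprn_ge0// exp_coeff_ge0// mulr_ge0.
- rewrite /= normrM normrM normfV normr_nat normrX.
  have -> : (a ^+ m *: exp_coeff (a * `|x|)) k =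
            a ^+ (k + m) * k`!%:R^-1 * `|x| ^+ k.
    by rewrite -[LHS]/(a ^+ m * ((a * `|x|) ^+ k / k`!%:R)) exprMn exprD; ring.
  by rewrite ler_wpM2r ?exprn_ge0// ler_wpM2r ?invr_ge0// ler_norm_mx_expr.
- exact/is_cvg_seriesZ/is_cvg_series_exp_coeff.
Qed.

Let expmx_partial A t i j n :
  (series (fun k => (k`!%:R)^-1 *: (t *: A) ^+ k) n) i j =
  pseries (coef A i j 0) t n.
Proof.
rewrite /pseries /series/= summxE; apply: eq_bigr => k _.
by rewrite scalemx_expr !mxE /coef addn0; ring.
Qed.

Let expmx_pseries A t i j :
  (expmx (t *: A)) i j = limn (pseries (coef A i j 0) t).
Proof.
pose L := \matrix_(i, j) limn (pseries (coef A i j 0) t).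
suff -> : expmx (t *: A) = L by rewrite mxE.
apply/cvg_lim => //; apply: cvg_mx => {}i {}j.
by under eq_fun do rewrite expmx_partial; rewrite mxE; exact: is_cvg_coef.
Qed.

Let cvg_expmx A t i j : pseries (coef A i j 0) t @ \oo --> (expmx (t *: A)) i j.
Proof. by rewrite expmx_pseries; exact: is_cvg_coef. Qed.

Let cvg_diffs_mulmx A t i j :
  pseries (coef A i j 1) t @ \oo --> (A *m expmx (t *: A)) i j.
Proof.
rewrite mxE.
have -> : pseries (coef A i j 1) t =
    (fun n => \sum_l A i l * pseries (coef A l j 0) t n).
  apply/funext => n; rewrite /pseries /series/=.
  under [RHS]eq_bigr do rewrite mulr_sumr.
  rewrite exchange_big/=; apply: eq_bigr => k _.
  rewrite /coef addn1 exprS mxE !mulr_suml; apply: eq_bigr => l _.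
  by rewrite addn0; ring.
by apply: cvg_sumr => l; apply: cvgM; [exact: cvg_cst|exact: cvg_expmx].
Qed.

Lemma is_derive_expmx A (t : R) :
  is_derive t (1 : R) (fun t => expmx (t *: A)) (A *m expmx (t *: A)).
Proof.
apply/is_derive_mxP => i j.
have -> : (fun t => (expmx (t *: A)) i j) =
          (fun t => limn (pseries (coef A i j 0) t)).
  by apply/funext => x; rewrite expmx_pseries.
have -> : (A *m expmx (t *: A)) i j =
          limn (pseries (pseries_diffs (coef A i j 0)) t).
  by rewrite coef_diffs; apply/esym/cvg_lim => //; exact: cvg_diffs_mulmx.
(* Termwise differentiation asks for convergence of the series and of its first two formal
   derivatives at some point beyond [|t|]; any such point would do. *)
apply: (@pseries_snd_diffs _ _ (`|t| + 1)); rewrite ?coef_diffs;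
  [exact: is_cvg_coef..|].
by rewrite [ltRHS]ger0_norm ?addr_ge0// ltrDl.
Qed.

Lemma expmx0 : expmx (0 : 'M[R]_N) = 1%:M.
Proof.
(* The partial sum at 0 is empty; from index 1 on, the partial sums are constantly the identity. *)
apply/cvg_lim => //; rewrite -cvg_shiftS.
have -> : (fun n => series (fun k => (k`!%:R)^-1 *: (0 : 'M[R]_N) ^+ k) n.+1) =
          (fun=> 1%:M).
  apply/funext => n; rewrite /series/= big_nat_recl//= expr0.
  rewrite fact0 invr1 scale1r.
  by rewrite big1 ?addr0// => k _; rewrite expr0n/= scaler0.
exact: cvg_cst.
Qed.

(** The differentiated series already converges to the left side; splitting A^{k+1} as A^k A shows
    that it also converges to the right side. *)
Lemma expmx_comm A (t : R) : A *m expmx (t *: A) = expmx (t *: A) *m A.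
Proof.
apply/matrixP => i j.
rewrite -(cvg_lim (@Rhausdorff R) (@cvg_diffs_mulmx A t i j)).
apply/cvg_lim => //; rewrite mxE.
have -> : pseries (coef A i j 1) t =
    (fun n => \sum_l pseries (coef A i l 0) t n * A l j).
  apply/funext => n; rewrite /pseries /series/=.
  under [RHS]eq_bigr do rewrite mulr_suml.
  rewrite exchange_big/=; apply: eq_bigr => k _.
  rewrite /coef addn1 exprSr mxE !mulr_suml; apply: eq_bigr => l _.
  by rewrite addn0; ring.
by apply: cvg_sumr => l; apply: cvgM; [exact: cvg_expmx|exact: cvg_cst].
Qed.

(** The product e^{xA} e^{(s+t-x)A} has zero derivative in x; compare its values at x = 0 and x =
    s. *)
Lemma expmxD A (s t : R) :
  expmx ((s + t) *: A) = expmx (s *: A) *m expmx (t *: A).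
Proof.
pose f x := expmx (x *: A) *m expmx ((s + t - x) *: A).
have /(is_derive_mx_0_is_cst 0 s) : forall x, is_derive x (1 : R) f 0.
  move=> x; have := is_derive_mulmx (is_derive_expmx A x)
    (is_derive_mx_subr (is_derive_expmx A (s + t - x))).
  move/is_derive_eq; apply.
  by rewrite expmx_comm mulmxN -!mulmxA subrr.
by rewrite /f scale0r expmx0 mul1mx subr0 addrAC subrr add0r.
Qed.

Lemma expmx_mulN A (t : R) : expmx (t *: A) *m expmx (- t *: A) = 1%:M.
Proof. by rewrite -expmxD subrr scale0r expmx0. Qed.

End matrix_exponential.

(** * Coercivity of positive definite matrices *)

Section positive_definite.
Context {R : realType} {N : nat}.
Implicit Types (A : 'M[R]_N) (x y : 'cV[R]_N).

Lemma dotmxE x : (x^T *m x) 0 0 = \sum_i x i 0 ^+ 2.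
Proof. by rewrite mxE; apply: eq_bigr => i _; rewrite mxE expr2. Qed.

Lemma dotmx_ge0 x : 0 <= (x^T *m x) 0 0.
Proof. by rewrite dotmxE; apply: sumr_ge0 => i _; exact: sqr_ge0. Qed.

Lemma sqr_coord_le_dotmx x i : x i 0 ^+ 2 <= (x^T *m x) 0 0.
Proof.
rewrite dotmxE (bigD1 i)//= lerDl; apply: sumr_ge0 => k _; exact: sqr_ge0.
Qed.

Lemma quadratic_form_le A x :
  (x^T *m A *m x) 0 0 <= (\sum_i \sum_j `|A i j|) * (x^T *m x) 0 0.
Proof.
have := sqr_coord_le_dotmx x; set q := (x^T *m x) 0 0 => xq.
rewrite -mulmxA mxE mulr_suml; apply: ler_sum => i _.
rewrite !mxE mulr_sumr mulr_suml; apply: ler_sum => j _.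
rewrite mulrCA (le_trans (ler_norm _))// normrM ler_wpM2l// normrM.
have := xq i; have := xq j.
rewrite -[x i 0 ^+ 2]real_normK ?num_real// -[x j 0 ^+ 2]real_normK ?num_real//.
(* Here 2uv <= u^2 + v^2 <= 2q, so each product of coordinates is at most q. *)
set u := `|x i 0|; set v := `|x j 0|; have := sqr_ge0 (u - v); nra.
Qed.

(** A nonzero row vector v with vA = 0 would make the quadratic form vanish at its transpose. *)
Lemma posdefmx_unit A : posdefmx A -> A \in unitmx.
Proof.
move=> Apos; rewrite unitmxE unitfE; apply/negP => /det0P[v v0 vA].
have : v^T != 0 by apply: contra v0 => /eqP v0; rewrite -[v]trmxK v0 trmx0.
by move=> /Apos; rewrite trmxK vA mul0mx mxE ltxx.
Qed.

(* With G = A^-1 and K bounding the quadratic form of G, expanding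
   0 <= (x - K^-1 G x)^T A (x - K^-1 G x) gives x^T A x >= K^-1 x^T x. *)
Lemma posdefmx_coercive A : A^T = A -> posdefmx A ->
  exists2 lambda : R, 0 < lambda &
    forall x, lambda * (x^T *m x) 0 0 <= (x^T *m A *m x) 0 0.
Proof.
move=> Asym Apos; have Au := posdefmx_unit Apos.
set G := invmx A; have Gsym : G^T = G by rewrite /G trmx_inv Asym.
(* The summand 1 makes [K] positive even when the sum is empty. *)
pose K := 1 + \sum_i \sum_j `|G i j|.
have K0 : 0 < K.
  by rewrite /K ltr_pwDl//; apply: sumr_ge0 => ? _; exact: sumr_ge0.
exists K^-1; first by rewrite invr_gt0.
move=> x; set q := (x^T *m x) 0 0.
have Gq : (x^T *m G *m x) 0 0 <= K * q.
  rewrite (le_trans (quadratic_form_le _ _))// -/q ler_wpM2r ?dotmx_ge0//.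
  by rewrite lerDr.
pose y := x - K^-1 *: (G *m x).
have y0 : 0 <= (y^T *m A *m y) 0 0.
  have [->|/Apos/ltW//] := eqVneq y 0.
  by rewrite mulmx0 mxE.
have yE : (y^T *m A *m y) 0 0 = (x^T *m A *m x) 0 0 - 2 * K^-1 * q
    + K^-1 ^+ 2 * (x^T *m G *m x) 0 0.
  have -> : y^T = x^T - K^-1 *: (x^T *m G).
    by rewrite /y linearB/= linearZ/= trmx_mul Gsym.
  rewrite /y /q.
  rewrite mulmxBl mulmxBr !mulmxBl -!scalemxAl -!scalemxAr.
  rewrite !mulmxA -[_ *m G *m A]mulmxA mulVmx// mulmx1.
  rewrite -[_ *m A *m G]mulmxA mulmxV// mulmx1 scalerA.
  move: (x^T *m A *m x) (x^T *m x) (x^T *m G *m x) => u v w.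
  by rewrite !mxE; ring.
rewrite yE in y0.
suff : K^-1 ^+ 2 * (x^T *m G *m x) 0 0 <= K^-1 * q by lra.
by rewrite expr2 -mulrA ler_wpM2l ?invr_ge0 ?(ltW K0)// ler_pdivrMl.
Qed.

End positive_definite.

(** * Exponential decay of e^{-tA} *)

Section exponential_decay.
Context {R : realType} {N : nat}.
Implicit Types (A : 'M[R]_N) (u : 'cV[R]_N).

Lemma is_derive_trmx {V : normedModType R} {m n : nat} (f : V -> 'M[R]_(m, n))
    (t v : V) (df : 'M[R]_(m, n)) :
  is_derive t v f df -> is_derive t v (fun x => (f x)^T) df^T.
Proof.
move=> /is_derive_mxP fd; apply/is_derive_mxP => i j.
by under eq_fun do rewrite mxE; rewrite mxE.
Qed.

Lemma is_derive_expmxN A (t : R) :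
  is_derive t (1 : R) (fun t => expmx (- t *: A)) (- A *m expmx (- t *: A)).
Proof.
under eq_fun do rewrite scaleNr -scalerN.
by rewrite scaleNr -scalerN; exact: is_derive_expmx.
Qed.

(* The energy q(t) = |e^{-tA} u|^2 satisfies q' = -2 y^T A y <= -2 lambda q. *)
Lemma expmxN_decay A : A^T = A -> posdefmx A ->
  exists2 lambda : R, 0 < lambda &
    forall u, exists2 c : R, 0 <= c & forall (t : R) i, 0 <= t ->
      `|(expmx (- t *: A) *m u) i 0| <= c * expR (- lambda * t).
Proof.
move=> Asym Apos; have [lambda l0 coerc] := posdefmx_coercive Asym Apos.
exists lambda => // u.
pose y t := expmx (- t *: A) *m u.
pose q t := ((y t)^T *m y t) 0 0.
(* The integrating factor turns the differential inequality for [q] into monotonicity of [h]. *)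
pose h t := expR (2 * lambda * t) * q t.
have dy t : is_derive t (1 : R) y (- A *m y t).
  have := is_derive_mulmx (is_derive_expmxN A t) (is_derive_cst u t 1).
  by move/is_derive_eq; apply; rewrite mulmx0 addr0 mulmxA.
have dq t : is_derive t (1 : R) q (- 2 * ((y t)^T *m A *m y t) 0 0).
  have /is_derive_mxP/(_ 0 0) := is_derive_mulmx (is_derive_trmx (dy t)) (dy t).
  move/is_derive_eq; apply.
  rewrite trmx_mul linearN/= Asym !mulmxN !mulNmx mulmxN mulmxA.
  by move: (_ *m y t) => w; rewrite !mxE; ring.
have de t : is_derive t (1 : R) (fun t => expR (2 * lambda * t))
    (2 * lambda * expR (2 * lambda * t)).
  have dm : is_derive t (1 : R) (fun t => 2 * lambda * t) (2 * lambda).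
    have := is_deriveZ (2 * lambda) (is_derive_id t (1 : R)).
    by move/is_derive_eq; apply; rewrite /GRing.scale/= mulr1.
  have := @is_derive1_comp R expR _ t _ _ (is_derive_expR _) dm.
  by move/is_derive_eq; apply; rewrite mulrC.
have dh t : is_derive t (1 : R) h (expR (2 * lambda * t) *
    (- 2 * ((y t)^T *m A *m y t) 0 0) +
    q t * (2 * lambda * expR (2 * lambda * t))).
  exact: is_deriveM.
have hle t : 0 <= t -> h t <= h 0.
  move=> t0; apply: (@ler0_derive1_nincry R h 0) => //.
  - move=> x _; rewrite derive1E (@derive_val _ _ _ _ _ _ _ (dh x)).
    have -> : forall e a b : R, e * (-2 * a) + b * (2 * lambda * e) =
      - (2 * e * (a - lambda * b)) by move=> *; ring.
    by rewrite oppr_le0 mulr_ge0 ?subr_ge0 ?mulr_ge0 ?expR_ge0//; exact: coerc.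
  - apply: derivable_within_continuous => x _; by case: (dh x).
(* This constant is the Euclidean norm of [u]; the bound is then proved in squared form. *)
exists (Num.sqrt (q 0)); first exact: sqrtr_ge0.
move=> t i t0; rewrite -/(y t).
have h0E : h 0 = q 0 by rewrite /h mulr0 expR0 mul1r.
rewrite -(@ler_pXn2r _ 2)// ?nnegrE// ?mulr_ge0 ?sqrtr_ge0 ?expR_ge0//.
rewrite exprMn sqr_sqrtr; last exact: dotmx_ge0.
rewrite real_normK ?num_real// (le_trans (sqr_coord_le_dotmx _ _))//.
rewrite -/(q t) -expRM_natl mulrA mulrN mulNr expRN ler_pdivlMr ?expR_gt0//.
by rewrite mulrC -h0E; exact: hle.
Qed.

(** On the half-line the function is c / lambda times the density of the exponential
    distribution. *)
Lemma integrable_expRN (lambda c : R) : 0 < lambda ->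
  (@lebesgue_measure R).-integrable `[0, +oo[
    (fun t => (c * expR (- lambda * t))%:E).
Proof.
move=> l0.
have ei : (@lebesgue_measure R).-integrable `[0, +oo[
    (EFin \o exponential_pdf lambda).
  exact: integrableS (integrable_exponential_pdf l0).
have : (@lebesgue_measure R).-integrable `[0, +oo[
    (fun x => ((c / lambda)%:E * (EFin \o exponential_pdf lambda) x)%E).
  exact: integrableZl.
apply: eq_integrable => // x; rewrite inE/= in_itv/= andbT => x0.
rewrite exponential_pdfE// -EFinM; congr EFin.
by rewrite mulrA -[c / _ * _]mulrA mulVf ?gt_eqF// mulr1.
Qed.

End exponential_decay.

(** * Antiderivatives of continuous functions on the whole line *)

Section antiderivative.
Context {R : realType}.
Local Notation mu := (@lebesgue_measure R).

(** As [f] vanishes on the negative half-line, its integrability on ]-oo, u] reduces to that on the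
    compact [0, u], and integrating from -oo gives an antiderivative. *)
Let antiderivative_pos (f : R -> R) : continuous f ->
  (forall x, x <= 0 -> f x = 0) ->
  exists F : R -> R, forall x, is_derive x (1 : R) F (f x).
Proof.
move=> cf f0; exists (fun x => \int[mu]_(t in `]-oo, x]) f t) => x.
(* The upper end [u] exceeds [x], so [x] is interior to ]-oo, u] as the fundamental theorem
   requires. *)
pose u := Num.max (x + 1) 1.
have u0 : 0 <= u by rewrite le_max ler01 orbT.
have fint : mu.-integrable `]-oo, u] (EFin \o f).
  have : mu.-integrable `[0, u] (EFin \o f).
    apply: continuous_compact_integrable; first exact: segment_compact.
    exact: continuous_subspaceT.
  move/(@integrable_mkcond _ _ _ mu _ (EFin \o f)
    (measurable_itv `[0, u])).1 => fu.
  apply: (@integrable_mkcond _ _ _ mu _ (EFin \o f)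
    (measurable_itv `]-oo, u])).2.
  move: fu.
  apply: eq_integrable => // z _; rewrite !patchE.
  rewrite !mem_setE !in_itv/=; case: (leP 0 z) => //= z0.
  by case: ifP => // _; rewrite /= f0// ltW.
have xu : x < u by rewrite lt_max ltrDl ltr01.
have [dF FE] := continuous_FTC1 xu fint (ltNyr _) (cf x).
by apply: DeriveDef => //; rewrite -derive1E.
Qed.

(* f is a constant plus a function vanishing on ]-oo, 0] plus the reflection of
   one, so integrals from -oo suffice and nothing has to be glued at 0. *)
Lemma continuous_antiderivative (f : R -> R) : continuous f ->
  exists F : R -> R, forall x, is_derive x (1 : R) F (f x).
Proof.
move=> cf.
pose g (h : R -> R) x := h (Num.max x 0) - h 0.
have cg h : continuous h -> continuous (g h).
  move=> ch x; apply: continuousB; last exact: cst_continuous.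
  apply: continuous_comp; last exact: ch.
  by apply: continuous_max; [exact: cvg_id|exact: cst_continuous].
have g0 h x : x <= 0 -> g h x = 0 by move=> x0; rewrite /g max_r// subrr.
have cfN : continuous (fun x => f (- x)).
  by move=> x; apply: continuous_comp; [exact: continuousN|exact: cf].
have [F1 dF1] := antiderivative_pos (cg _ cf) (g0 _).
have [F2 dF2] := antiderivative_pos (cg _ cfN) (g0 _).
exists (fun x => F1 x - F2 (- x) + f 0 * x) => x.
have dF2N : is_derive x (1 : R) (F2 \o -%R) (g (fun x => f (- x)) (- x) * -1).
  exact: is_derive1_comp.
have := is_deriveD (is_deriveB (dF1 x) dF2N)
  (is_deriveZ (f 0) (is_derive_id x (1 : R))).
move/is_derive_eq; apply; rewrite /g /GRing.scale/= oppr0.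
(* On each half-line one truncated part vanishes and the other contributes f(x) - f(0). *)
case: (leP x 0) => x0; last first.
  by rewrite (@max_r _ _ (- x)) ?oppr_le0 ?(ltW x0)// oppr0; ring.
by rewrite max_l ?oppr_ge0// opprK; ring.
Qed.

End antiderivative.

(** * Improper integrals as limits of antiderivatives *)

Section improper_integral.
Context {R : realType}.
Local Notation mu := (@lebesgue_measure R).

(** Along any sequence u_n tending to +oo, the truncations of [h] to [0, u_n] are dominated by |h|,
    and their integrals are H(u_n) - H(0). *)
Lemma cvgy_antiderivative (h H : R -> R) : continuous h ->
  (forall x, is_derive x (1 : R) H (h x)) ->
  mu.-integrable `[0, +oo[ (EFin \o h) ->
  H x @[x --> +oo] --> H 0 + \int[mu]_(t in `[0, +oo[) h t.
Proof.
move=> ch dH ih; apply/cvg_pinftyP => u uy.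
have mh : measurable_fun setT h by exact: continuous_measurable_fun.
pose f_ n := EFin \o (h \_ `[0, u n]).
pose D : set R := `[0, +oo[%classic.
have [_ _] : [/\ mu.-integrable D (EFin \o h),
    [sequence \int[mu]_(x in D) `|f_ n x - (h x)%:E|]_n @ \oo --> 0 &
    [sequence \int[mu]_(x in D) f_ n x]_n @ \oo -->
      \int[mu]_(x in D) (h x)%:E]%E.
  apply: (@dominated_convergence _ _ _ mu _ _ f_ _ (abse \o (EFin \o h))) => //.
  - exact: measurable_itv.
  - move=> n; apply/measurable_EFinP; apply: measurable_funTS.
    by apply/(measurable_restrictT _ _).1 => //; exact: measurable_funTS.
  - by apply/measurable_EFinP; exact: measurable_funTS.
  - apply: aeW => x; rewrite /D/= in_itv/= andbT => x0.
    apply: cvg_near_cst; near=> n.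
    rewrite /f_/= patchE mem_setE in_itv/= x0.
    by rewrite ifT//; near: n; exact: (cvgryPge _).1.
  - exact: integrable_abse.
  - apply: aeW => x n _; rewrite /f_/= patchE.
    by case: ifP => // _; rewrite normr0 lee_fin.
have ifin : (\int[mu]_(x in D) (h x)%:E)%E \is a fin_num.
  by apply: integrable_fin_num ih => //; exact: measurable_itv.
rewrite -(fineK ifin) => /fine_cvg Hc.
apply: (@cvg_trans _ (H 0 + fine (\int[mu]_(x in D) f_ n x)%E @[n --> \oo])).
  apply: near_eq_cvg; near=> n.
  have u0 : 0 < u n by near: n; exact: (cvgryPgt _).1.
  have dHx x : derivable H x 1 by case: (dH x).
  have cH : continuous H.
    by move=> x; apply/differentiable_continuous/derivable1_diffP.
  have dHoo : derivable_oo_LRcontinuous H 0 (u n).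
    split; [by move=> x _; exact: dHx|exact/cvg_at_right_filter/cH|].
    exact/cvg_at_left_filter/cH.
  have Hh : {in `]0, u n[, H^`()%classic =1 h}.
    by move=> x _; rewrite derive1E (@derive_val _ _ _ _ _ _ _ (dH x)).
  have := continuous_FTC2 u0 (continuous_subspaceT ch) dHoo Hh.
  have <- : (\int[mu]_(x in D) f_ n x = \int[mu]_(x in `[0%R, u n]) (h x)%:E)%E.
    rewrite integral_mkcond [RHS]integral_mkcond; apply: eq_integral => x _.
    rewrite /f_ /D /= /patch /= !mem_setE !in_itv/= andbT.
    by case: (0 <= x); case: (x <= u n).
  by move=> ->/=; rewrite subrKC.
by apply: cvgD => //; exact: cvg_cst.
Unshelve. all: by end_near. Qed.

End improper_integral.

(** * The convolution integral and its differential equation *)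

Section convolution.
Context {R : realType} {N : nat}.
Variables (A : 'M[R]_N) (C : 'cV[R]_N).
Hypotheses (Asym : A^T = A) (Apos : posdefmx A).

Let expmxNM_continuous i :
  continuous (fun t : R => (expmx (- t *: A) *m C) i 0).
Proof.
move=> t; apply/differentiable_continuous/derivable1_diffP.
by have /is_derive_mxP/(_ i 0)[] :=
  is_derive_mulmx (is_derive_expmxN A t) (is_derive_cst C t 1).
Qed.

Lemma cvgy_expmxN (u : 'cV[R]_N) :
  expmx (- t *: A) *m u @[t --> +oo] --> (0 : 'cV[R]_N).
Proof.
apply: cvg_mx => i j; rewrite ord1 mxE.
have [lambda l0 /(_ u)[c c0 le_c]] := expmxN_decay Asym Apos.
have cvg_exp : c * expR (- (lambda * t)) @[t --> +oo] --> 0.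
  rewrite -[X in _ --> X](mulr0 c); apply: cvgM; first exact: cvg_cst.
  apply: (@cvg_comp _ _ _ (fun t => lambda * t) (fun x => expR (- x))).
    exact: (gt0_cvgMry l0).
  exact: cvgr_expR.
apply/norm_cvg0P; apply: (squeeze_cvgr _ (cvg_cst 0) cvg_exp).
near=> t; rewrite normr_ge0/= -mulNr; apply: le_c.
by near: t; exact: nbhs_pinfty_ge.
Unshelve. all: by end_near. Qed.

(** With [g] bounded by B, the decay of e^{-tau A} C gives an exponential majorant. *)
Lemma integrable_convolution (g : R -> R) : continuous g -> bounded_fun g ->
  integrable_cV `[0, +oo[ (fun tau => g tau *: (expmx (- tau *: A) *m C)).
Proof.
move=> cg /pinfty_ex_gt0[B B0 gB] i.
have [lambda l0 /(_ C)[c c0 le_c]] := expmxN_decay Asym Apos.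
apply: le_integrable (integrable_expRN (B * c) l0) => //.
  apply/measurable_EFinP; apply: measurable_funTS.
  apply: continuous_measurable_fun => t.
  under eq_fun do rewrite mxE.
  by apply: cvgM; [exact: cg|exact: expmxNM_continuous].
move=> t; rewrite /= in_itv/= andbT => t0.
rewrite lee_fin mxE normrM [leRHS]ger0_norm; last first.
  by rewrite !mulr_ge0 ?expR_ge0// ltW.
by rewrite -mulrA ler_pM//; [exact: gB|exact: le_c].
Qed.

Variable g : R -> R.
Hypotheses (cg : continuous g) (bg : bounded_fun g).

(** For g(s) = omega(phi^s m) this is the synchronisation evaluated at phi^t m. *)
Let conv (t : R) : 'cV[R]_N := integral_cV `[0, +oo[
  (fun tau => g (- tau + t) *: (expmx (- tau *: A) *m C)).

Lemma integrable_shift_convolution t : integrable_cV `[0, +oo[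
  (fun tau => g (- tau + t) *: (expmx (- tau *: A) *m C)).
Proof.
apply: (integrable_convolution (g := fun tau => g (- tau + t))).
  move=> x; apply: continuous_comp; last exact: cg.
  by apply: continuousD; [exact: continuousN|exact: cst_continuous].
have [B B0 gB] := pinfty_ex_gt0 bg.
by exists B; split; [exact: num_real|move=> M BM x _];
  exact: le_trans (gB _ I) (ltW BM).
Qed.

Lemma exists_convolution_antiderivative : exists K : R -> 'cV[R]_N,
  forall s, is_derive s (1 : R) K (g s *: (expmx (s *: A) *m C)).
Proof.
have kc i : continuous (fun s => (g s *: (expmx (s *: A) *m C)) i 0).
  move=> s; under eq_fun do rewrite mxE.
  apply: cvgM; first exact: cg.
  apply/differentiable_continuous/derivable1_diffP.
  by have /is_derive_mxP/(_ i 0)[] :=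
    is_derive_mulmx (is_derive_expmx A s) (is_derive_cst C s 1).
have [K dK] := choice (fun i => continuous_antiderivative (@kc i)).
exists (fun s => \col_i K i s) => s; apply/is_derive_mxP => i j.
by rewrite ord1; under eq_fun do rewrite mxE.
Qed.

Section antiderivative.
Variable K : R -> 'cV[R]_N.
Hypothesis dK : forall s, is_derive s (1 : R) K (g s *: (expmx (s *: A) *m C)).

(** [H] is an antiderivative in tau of the integrand of [conv t], so it tends to H(0) + conv t; the
    claim is the negative of this limit. *)
Let cvgy_shift t i :
  (expmx (- t *: A) *m K (t - tau)) i 0 @[tau --> +oo] -->
  (expmx (- t *: A) *m K t - conv t) i 0.
Proof.
pose h tau : 'cV[R]_N := g (- tau + t) *: (expmx (- tau *: A) *m C).
pose H tau := - (expmx (- t *: A) *m K (t - tau)).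
have dH tau : is_derive tau (1 : R) H (h tau).
  have := is_derive_mulmx (is_derive_cst (expmx (- t *: A)) tau 1)
    (is_derive_mx_subr (dK (t - tau))).
  move=> /is_deriveN/is_derive_eq; apply.
  rewrite mul0mx add0r mulmxN opprK -scalemxAr mulmxA -expmxD.
  by rewrite addrA addNr add0r addrC.
have dHi tau : is_derive tau (1 : R) (fun x => H x i 0) (h tau i 0).
  exact: (is_derive_mxP _ _ _ _).1 (dH tau) i 0.
have hc : continuous (fun tau => h tau i 0).
  move=> tau; under eq_fun do rewrite mxE.
  apply: cvgM; last exact: expmxNM_continuous.
  apply: continuous_comp; last exact: cg.
  by apply: continuousD; [exact: continuousN|exact: cst_continuous].
have /cvgN := cvgy_antiderivative hc dHi (integrable_shift_convolution t i).
rewrite /H subr0 [(- (_ *m K t)) i 0]mxE opprD opprK.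
rewrite [X in _ --> X -> _]
  (_ : _ = (expmx (- t *: A) *m K t - conv t) i 0); last first.
  by rewrite !mxE.
apply: cvg_trans; apply: near_eq_cvg; near=> x.
by rewrite fctE [(- (_ *m _)) i 0]mxE opprK.
Unshelve. all: by end_near. Qed.

(** The case t = 0 of the preceding limit identifies the limit of [K] at -oo, which a shift by [t]
    does not change. *)
Let cvgy_K t i : K (t - tau) i 0 @[tau --> +oo] --> (K 0 - conv 0) i 0.
Proof.
have := @cvgy_shift 0 i; rewrite oppr0 scale0r expmx0.
under eq_fun do rewrite mul1mx sub0r.
rewrite mul1mx => cvgK.
have -> : (fun tau => K (t - tau) i 0) =
          (fun x => K (- x) i 0) \o (fun x => x - t).
  by apply/funext => x /=; rewrite opprB.
apply: cvg_comp cvgK; apply/cvgryPge => a; near=> x.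
by rewrite lerBrDr; near: x; apply: nbhs_pinfty_ge; exact: num_real.
Unshelve. all: by end_near. Qed.

(** The limit of e^{-tA} K(t - tau) is computed twice, directly and through the limit of [K];
    uniqueness of limits equates the results. *)
Lemma convolutionE t : conv t = expmx (- t *: A) *m (conv 0 + (K t - K 0)).
Proof.
have lim1 i := @cvgy_shift t i.
have lim2 i : (expmx (- t *: A) *m K (t - tau)) i 0 @[tau --> +oo] -->
    (expmx (- t *: A) *m (K 0 - conv 0)) i 0.
  under eq_fun do rewrite mxE; rewrite mxE.
  by apply: cvg_sumr => j; apply: cvgM; [exact: cvg_cst|exact: cvgy_K].
have : expmx (- t *: A) *m K t - conv t = expmx (- t *: A) *m (K 0 - conv 0).
  apply/colP => i; rewrite -(cvg_lim (@Rhausdorff R) (lim1 i)).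
  exact/cvg_lim.
move/eqP; rewrite subr_eq addrC -subr_eq -mulmxBr => /eqP <-.
by congr (_ *m _); rewrite opprB addrCA.
Qed.

End antiderivative.

Lemma is_derive_convolution (w : 'cV[R]_N) t :
  let x t := conv t + expmx (- t *: A) *m w in
  is_derive t (1 : R) x (- A *m x t + g t *: C).
Proof.
move=> x; have [K dK] := exists_convolution_antiderivative.
(* In this form the integral is gone: the product rule applies, and e^{-tA} cancels the e^{tA} in
   the derivative of [K]. *)
have xE : x = (fun t => expmx (- t *: A) *m (conv 0 - K 0 + w + K t)).
  apply/funext => s; rewrite /x (convolutionE dK) -mulmxDr; congr (_ *m _).
  by rewrite [K s - K 0]addrC addrA [LHS]addrAC.
have := is_derive_mulmx (is_derive_expmxN A t)
  (is_deriveD (is_derive_cst (conv 0 - K 0 + w) t 1) (dK t)).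
rewrite xE; move/is_derive_eq; apply.
rewrite add0r mulmxA -scalemxAr [_ *m (_ *m C)]mulmxA -expmxD addNr scale0r.
by rewrite expmx0 mul1mx.
Qed.

End convolution.

(** * Uniqueness of solutions and the synchronisation theorem *)

Lemma linear_ode_unique {R : realType} {N : nat} (A : 'M[R]_N)
    (b x y : R -> 'cV[R]_N) :
  (forall t, is_derive t (1 : R) x (- A *m x t + b t)) ->
  (forall t, is_derive t (1 : R) y (- A *m y t + b t)) ->
  x 0 = y 0 -> x = y.
Proof.
move=> dx dy xy0; apply/funext => t; apply/eqP; rewrite -subr_eq0; apply/eqP.
pose z t := expmx (t *: A) *m (x t - y t).
have /(is_derive_mx_0_is_cst t 0) : forall s, is_derive s (1 : R) z 0.
  move=> s; have := is_derive_mulmx (is_derive_expmx A s)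
    (is_deriveB (dx s) (dy s)).
  move/is_derive_eq; apply.
  (* The forcing term [b] cancels in the difference, and the remaining two terms cancel because [A]
     commutes with its exponential. *)
  rewrite opprD addrACA subrr addr0 -mulmxBr mulmxA mulmxN -expmx_comm mulNmx.
  by rewrite subrr.
rewrite /z xy0 subrr mulmx0 => /(congr1 (mulmx (expmx (- t *: A)))).
by rewrite mulmxA -{2}[t]opprK expmx_mulN mul1mx mulmx0.
Qed.

(** The integral is a total operation, so the integrability clause certifies that the formulas
    denote genuine integrals. *)
Theorem proposition4p1 (R : realType) (n : nat) (M : manifold R n)
    (V : vectorField M) (phi : R -> M -> M) (Vphi : is_flow V phi)
    (N : nat) (A : 'M[R]_N) (C : 'cV[R]_N)
    (Asym : A^T = A) (Apos : posdefmx A)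
    (omega : M -> R) (omega_cont : continuous omega)
    (omega_bounded : bounded_fun omega) :
  [/\ forall (m : M) (t : R),
        integrable_cV `[0, +oo[
          (fun tau => omega (phi (- tau + t) m) *: (expmx (- tau *: A) *m C)),
      forall (m : M) (x0 : 'cV[R]_N),
        unique (is_solution (linear_reservoir A C) phi omega m x0)
          (fun t =>
             integral_cV `[0, +oo[
               (fun tau =>
                  omega (phi (- tau + t) m) *: (expmx (- tau *: A) *m C))
             + expmx (- t *: A) *m
               (x0 - integral_cV `[0, +oo[
                  (fun tau =>
                     omega (phi (- tau) m) *: (expmx (- tau *: A) *m C)))) &
      generalised_synchronisation (linear_reservoir A C) phi omega setT
        (fun m => integral_cV `[0, +oo[
           (fun tau =>
              omega (phi (- tau) m) *: (expmx (- tau *: A) *m C)))].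
Proof.
have [_ phi0 phiD phicurve] := Vphi.
have cg m : continuous (fun s => omega (phi s m)).
  move=> s; apply: (@continuous_comp _ _ _ (phi ^~ m)); last exact: omega_cont.
  exact: (phicurve m).1.
have bg m : bounded_fun (fun s => omega (phi s m)).
  have [B [Breal omegaB]] := omega_bounded.
  by exists B; split => // B' BB' s _; exact: omegaB.
pose f m := integral_cV `[0, +oo[
  (fun tau => omega (phi (- tau) m) *: (expmx (- tau *: A) *m C)).
pose sol m x0 t := integral_cV `[0, +oo[
    (fun tau => omega (phi (- tau + t) m) *: (expmx (- tau *: A) *m C))
  + expmx (- t *: A) *m (x0 - f m).
(* By the group law of the flow, the first integral is [f] along the orbit of [m]. *)
have solE m x0 t : sol m x0 t = f (phi t m) + expmx (- t *: A) *m (x0 - f m).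
  congr (integral_cV _ _ + _); apply/funext => tau.
  by rewrite phiD.
have solP m x0 : unique (is_solution (linear_reservoir A C) phi omega m x0)
      (sol m x0).
  have dsol t : is_derive t (1 : R) (sol m x0)
      (- A *m sol m x0 t + omega (phi t m) *: C).
    exact: (is_derive_convolution C Asym Apos (cg m) (bg m) (x0 - f m) t).
  have sol0 : sol m x0 0 = x0.
    by rewrite solE phi0 oppr0 scale0r expmx0 mul1mx subrKC.
  split=> [//|y [y0 dy]].
  by apply: (linear_ode_unique dsol dy); rewrite sol0 y0.
split=> [m t|//|r m _].
  exact: (integrable_shift_convolution C Asym Apos (cg m) (bg m) t).
exists (sol m r) => //.
rewrite -[X in _ --> X](@normr0 _ 'cV[R]_N); apply: cvg_norm.
(* The synchronisation error is exactly -e^{-tA} (r - f(m)). *)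
have /cvgN := cvgy_expmxN Asym Apos (r - f m); rewrite oppr0.
apply: cvg_trans; apply: near_eq_cvg; near=> t.
by rewrite fctE -/(f _) solE opprD addrA subrr sub0r.
Unshelve. all: by end_near. Qed.
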